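(* For every instance of the Minimum Cost Markov Chain problem (as described in the context), the Iterative Algorithm terminates after finitely many iterations. Furthermore, if it terminates with $\mathbf p_n=\mathbf p_{n-1}$ and outputs $\mathbf S(\mathbf p_n)$, then $\mathbf S(\mathbf p_n)$ is a minimum cost permissible Markov chain, and the multi-typed intersection point associated with $\mathbf S(\mathbf p_n)$ lies in $\mathbb{H}$.
   Context: Fix an integer $m>1$. For each $k\in\{0,\ldots,m-1\}$ let $\mathbb{S}_k$ be a finite nonempty set of permissible states of type $k$. Each $S\in\mathbb{S}_k$ has a real cost $\ell(S)\ge 0$ and transition probabilities $q_0(S),\ldots,q_{m-1}(S)\ge 0$ with $\sum_j q_j(S)=1$ and $q_0(S)>0$. A permissible Markov chain is a tuple $\mathbf S=(S_0,\ldots,S_{m-1})$ with $S_k\in\mathbb{S}_k$; it is the Markov chain on $\{0,\ldots,m-1\}$ whose transition probability from $k$ to $j$ is $q_j(S_k)$. It has a unique stationary distribution $\pi(\mathbf S)=(\pi_0,\ldots,\pi_{m-1})$ and cost $\mathrm{cost}(\mathbf S)=\sum_k\ell(S_k)\pi_k(\mathbf S)$. The Minimum Cost Markov Chain problem asks for a permissible $\mathbf S$ minimizing $\mathrm{cost}(\mathbf S)$. For $\mathbf x=(x_1,\ldots,x_{m-1})\in\mathbb{R}^{m-1}$ define $f_0(\mathbf x,S)=\ell(S)+\sum_{j=1}^{m-1}q_j(S)x_j$ ($S\in\mathbb{S}_0$) and, for $k\ge1$, $f_k(\mathbf x,S)=\ell(S)+\sum_{j=1}^{m-1}q_j(S)x_j-x_k$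 ($S\in\mathbb{S}_k$). Let $g_k(\mathbf x)=\min_{S\in\mathbb{S}_k}f_k(\mathbf x,S)$, let $S_k(\mathbf x)$ denote a minimizer (argmin), $\mathbf S(\mathbf x)=(S_0(\mathbf x),\ldots,S_{m-1}(\mathbf x))$, $h(\mathbf x)=\min_k g_k(\mathbf x)$, and $\mathbb{H}=\{(\mathbf x,y)\in\mathbb{R}^m: 0\le y\le h(\mathbf x)\}$. For every permissible $\mathbf S$, the $m$ equations $y=f_k(\mathbf x,S_k)$, $k=0,\ldots,m-1$, have a unique common solution $(\mathbf x,y)\in\mathbb{R}^{m}$, called the multi-typed intersection point corresponding to $\mathbf S$ (and then $y=\mathrm{cost}(\mathbf S)$). The Iterative Algorithm: let $\mathbf p_0\in\mathbb{R}^{m-1}$ be the $\mathbf x$-part of the multi-typed intersection point of an arbitrary permissible chain; for $i=1,2,\ldots$ let $\mathbf p_i$ be the $\mathbf x$-part of the multi-typed intersection point corresponding to $\mathbf S(\mathbf p_{i-1})$; stop as soon as $\mathbf p_i=\mathbf p_{i-1}$ and output $\mathbf S(\mathbf p_i)$. *)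

(* Defs.v *)
From HB Require Import structures.
From mathcomp Require Import all_boot all_order all_algebra.
From mathcomp Require Import boolp classical_sets reals.

Set Implicit Arguments.
Unset Strict Implicit.
Unset Printing Implicit Defensive.

Import Order.TTheory GRing.Theory Num.Theory.

Local Open Scope ring_scope.

(* The number of types is m = n.+1, with types indexed by 'I_n.+1; a vector
   x = (x_1, ..., x_(m-1)) of R^(m-1) is a row x : 'rV[R]_n whose entry x 0 i
   is the coordinate of index lift ord0 i, i.e. x_(i+1). *)

Record instance (R : realType) (n : nat) := Instance {
  state : 'I_n.+1 -> finType;
  state_nonempty : forall k, (0 < #|state k|)%N;
  ell : forall k, state k -> R;
  q : forall k, state k -> 'I_n.+1 -> R;
  ell_ge0 : forall k (s : state k), 0 <= ell s;
  q_ge0 : forall k (s : state k) j, 0 <= q s j;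
  q_sum1 : forall k (s : state k), \sum_j q s j = 1;
  q0_gt0 : forall k (s : state k), 0 < q s ord0
}.

Section Definitions.
Context {R : realType} {n : nat} (P : instance R n).

Definition chain := {dffun forall k : 'I_n.+1, state P k}.

Definition is_stationary (S : chain) (p : 'I_n.+1 -> R) : Prop :=
  [/\ forall k, 0 <= p k,
      \sum_k p k = 1
    & forall j, p j = \sum_k p k * q (S k) j].

Definition f (x : 'rV[R]_n) (k : 'I_n.+1) (s : state P k) : R :=
  let lin := ell s + \sum_(i < n) q s (lift ord0 i) * x 0 i in
  if unlift ord0 k is Some i then lin - x 0 i else lin.

Definition is_intersection (S : chain) (xy : 'rV[R]_n * R) : Prop :=
  forall k, xy.2 = f xy.1 (S k).

Definition some_state (k : 'I_n.+1) : state P k :=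
  enum_val (Ordinal (state_nonempty P k)).

Definition g (x : 'rV[R]_n) (k : 'I_n.+1) : R :=
  \big[Num.min/f x (some_state k)]_(s : state P k) f x s.

Definition h (x : 'rV[R]_n) : R :=
  \big[Num.min/g x ord0]_(k < n.+1) g x k.

Definition H : set ('rV[R]_n * R) :=
  [set xy | 0 <= xy.2 /\ xy.2 <= h xy.1].

Definition is_argmin (x : 'rV[R]_n) (S : chain) : Prop :=
  forall k, f x (S k) = g x k.

(* The stationary equations together with \sum_k p k = 1, and the equations
   y = f_k(x, S_k), have the same coefficient matrix mat S up to transposition;
   it is invertible because q_0 > 0. *)

Definition ext (x : 'rV[R]_n) (k : 'I_n.+1) : R :=
  if unlift ord0 k is Some i then x 0 i else 0.

Lemma ext0 x : ext x ord0 = 0.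
Proof. by rewrite /ext unlift_none. Qed.

Lemma extS x i : ext x (lift ord0 i) = x 0 i.
Proof. by rewrite /ext liftK. Qed.

Lemma fE x k (s : state P k) :
  f x s = ell s + \sum_j q s j * ext x j - ext x k.
Proof.
rewrite big_ord_recl ext0 mulr0 add0r /f.
under [in RHS]eq_bigr do rewrite extS.
by rewrite /ext; case: unliftP => [i|] _; rewrite ?subr0.
Qed.

Lemma superharmonic (S : chain) (d : 'I_n.+1 -> R) (y : R) :
    d ord0 = 0 -> (forall k, \sum_j q (S k) j * d j <= d k + y) ->
  0 <= y /\ (y = 0 -> forall k, 0 <= d k).
Proof.
move=> d0 sup.
have [k0 _ mn] : exists2 k0, true & forall j, d k0 <= d j.
  by case: (@arg_minP _ _ _ ord0 xpredT d) => // k _ mk; exists k => // j; apply: mk.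
have dk0 : d k0 <= 0 by rewrite -d0.
have q0 := q0_gt0 (S k0).
have le1 : - (q (S k0) ord0 * d k0) <= y.
  rewrite -(lerD2l (d k0)); apply: le_trans (sup k0).
  rewrite big_ord_recl d0 mulr0 add0r.
  have -> : d k0 - q (S k0) ord0 * d k0 =
            \sum_(i < n) q (S k0) (lift ord0 i) * d k0.
    rewrite -mulr_suml.
    have /eqP := q_sum1 (S k0); rewrite big_ord_recl addrC eq_sym -subr_eq.
    by move=> /eqP <-; rewrite mulrBl mul1r.
  by apply: ler_sum => i _; apply: ler_wpM2l => //; apply: q_ge0.
split=> [|y0 k].
  by apply: le_trans le1; rewrite oppr_ge0 pmulr_rle0.
apply: le_trans (mn k).
by move: le1; rewrite y0 oppr_le0 pmulr_rge0.
Qed.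

Definition mat (S : chain) : 'M[R]_n.+1 :=
  \matrix_(k, j) if j == ord0 then 1 else (k == j)%:R - q (S k) j.

Lemma matE (S : chain) (v : 'cV[R]_n.+1) (d : 'I_n.+1 -> R) k :
    d ord0 = 0 -> (forall i, d (lift ord0 i) = v (lift ord0 i) 0) ->
  (mat S *m v) k 0 = v ord0 0 + d k - \sum_j q (S k) j * d j.
Proof.
move=> d0 dS.
rewrite mxE big_ord_recl mxE eqxx mul1r -addrA; congr (_ + _).
have -> : d k = \sum_j (k == j)%:R * d j.
  rewrite (bigD1 k) //= eqxx mul1r big1 ?addr0 // => j /negPf.
  by rewrite eq_sym => ->; rewrite mul0r.
rewrite -sumrB [RHS]big_ord_recl d0 !mulr0 subr0 add0r.
by apply: eq_bigr => i _; rewrite mxE dS /= mulrBl.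
Qed.

Lemma mat_ge0 (S : chain) (v : 'cV[R]_n.+1) :
  (forall k, 0 <= (mat S *m v) k 0) ->
  0 <= v ord0 0 /\ (v ord0 0 = 0 -> forall k, 0 <= v k 0).
Proof.
move=> v_ge0.
pose d j := if j == ord0 then 0 else v j 0.
have [//||] := @superharmonic S d (v ord0 0).
  by move=> k; have := v_ge0 k; rewrite (@matE S v d) // subr_ge0 addrC.
move=> y0 dge; split=> // /[dup] y00 /dge {}dge k.
by have := dge k; rewrite /d; case: eqP => // ->; rewrite y00.
Qed.

Lemma mat_unit (S : chain) : mat S \in unitmx.
Proof.
rewrite -unitmx_tr -row_free_unit -kermx_eq0; apply/eqP/row_matrixP => i.
set u := row i _.
have uA : mat S *m u^T = 0.
  by apply: trmx_inj; rewrite trmx_mul trmxK trmx0 -row_mul mulmx_ker row0.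
rewrite row0; apply: trmx_inj; rewrite trmx0.
move: (u^T) uA => {u} v vA.
have [k|y0 d0] := @mat_ge0 S v; first by rewrite vA mxE.
have [k|y1 d1] := @mat_ge0 S (- v); first by rewrite mulmxN vA oppr0 mxE.
rewrite mxE oppr_ge0 in y1; rewrite mxE in d1.
have v0 : v ord0 0 = 0 by apply/eqP; rewrite eq_le y0 y1.
rewrite v0 oppr0 in d1.
apply/colP => k; rewrite mxE; apply/eqP; rewrite eq_le d0 // andbT -oppr_ge0.
by have := d1 erefl k; rewrite mxE.
Qed.

Lemma stationaryE (S : chain) (p : 'I_n.+1 -> R) : \sum_k p k = 1 ->
  (forall j, p j = \sum_k p k * q (S k) j) <->
  (\row_k p k) *m mat S = delta_mx 0 ord0.
Proof.
move=> p1; pose e j := p j - \sum_k p k * q (S k) j.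
have eE j : j != ord0 -> ((\row_k p k) *m mat S) 0 j = e j.
  move=> /negPf j0; rewrite mxE /e.
  have -> : p j = \sum_k p k * (k == j)%:R.
    rewrite (bigD1 j) //= eqxx mulr1 big1 ?addr0 // => k /negPf ->.
    by rewrite mulr0.
  by rewrite -sumrB; apply: eq_bigr => k _; rewrite !mxE j0 mulrBr.
have e0 : \sum_j e j = 0.
  rewrite sumrB exchange_big /= p1.
  under eq_bigr do rewrite -mulr_sumr q_sum1 mulr1.
  by rewrite p1 subrr.
split=> [st|/rowP st].
  apply/rowP => j; rewrite [RHS]mxE eqxx /=; case: (eqVneq j ord0) => [->|j0].
    by rewrite mxE -[RHS]p1; apply: eq_bigr => k _; rewrite !mxE eqxx mulr1.
  by rewrite eE // /e -st subrr.
have eS j : j != ord0 -> e j = 0.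
  by move=> j0; rewrite -eE // st mxE (negPf j0) andbF.
move=> j; apply/eqP; rewrite -subr_eq0 -/(e j); apply/eqP.
case: (eqVneq j ord0) => [->|/eS //].
by move: e0; rewrite (bigD1 ord0) //= big1 ?addr0 // => i /eS.
Qed.

Lemma stationary_ex_uniq (S : chain) : exists! p, is_stationary S p.
Proof.
pose r : 'rV[R]_n.+1 := delta_mx 0 ord0 *m invmx (mat S).
pose p (k : 'I_n.+1) : R := r 0 k.
have pE : \row_k p k = r.
  by apply/rowP => k; rewrite mxE.
have pA : \row_k p k *m mat S = delta_mx 0 ord0.
  by rewrite pE /r -mulmxA mulVmx ?mat_unit // mulmx1.
have p1 : \sum_k p k = 1.
  have <- : (\row_k p k *m mat S) 0 ord0 = 1 by rewrite pA mxE !eqxx.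
  rewrite mxE.
  by apply: eq_bigr => k _; rewrite !mxE eqxx mulr1.
exists p; split=> [|p' [_ p'1 /(stationaryE S p'1) p'st]].
  split=> //; last exact/(stationaryE S p1).
  move=> k; have -> : p k = (invmx (mat S) *m delta_mx k 0 : 'cV_n.+1) ord0 0.
    by rewrite /p /r -colE -rowE !mxE.
  have [j|//] := @mat_ge0 S (invmx (mat S) *m delta_mx k 0).
  by rewrite mulmxA mulmxV ?mat_unit // mul1mx mxE ler0n.
apply/funext => k.
have : \row_k p' k = \row_k p k by rewrite pE /r -p'st mulmxK ?mat_unit.
by move/rowP/(_ k); rewrite !mxE.
Qed.

Lemma intersection_ex_uniq (S : chain) : exists! xy, is_intersection S xy.
Proof.
pose vec (xy : 'rV[R]_n * R) : 'cV[R]_n.+1 :=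
  \col_k if unlift ord0 k is Some i then xy.1 0 i else xy.2.
pose b : 'cV[R]_n.+1 := \col_k ell (S k).
have iE xy : is_intersection S xy <-> mat S *m vec xy = b.
  have dE i : ext xy.1 (lift ord0 i) = vec xy (lift ord0 i) 0.
    by rewrite extS mxE liftK.
  have v0 : vec xy ord0 0 = xy.2 by rewrite mxE unlift_none.
  split=> [isect|/colP eqb k].
    apply/colP => k; rewrite (matE S k (ext0 _) dE) v0 (isect k) fE mxE.
    by rewrite subrK addrK.
  have := eqb k; rewrite (matE S k (ext0 _) dE) v0 fE mxE => <-.
  by rewrite subrK addrK.
pose v := invmx (mat S) *m b.
pose xy := (\row_i v (lift ord0 i) 0, v ord0 0) : 'rV[R]_n * R.
have vE : vec xy = v.
  by apply/colP => k; rewrite mxE; case: unliftP => [i ->|->] //=; rewrite mxE.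
exists xy; split; first by apply/iE; rewrite vE mulmxA mulmxV ?mat_unit // mul1mx.
move=> [x' y'] /iE e.
have {}e : vec (x', y') = v by rewrite /v -e mulKmx ?mat_unit.
rewrite /xy -e; congr (_, _).
  by apply/rowP => i; rewrite !mxE liftK.
by rewrite mxE unlift_none.
Qed.

Definition stationary (S : chain) : 'I_n.+1 -> R :=
  sval (cid (stationary_ex_uniq S)).

Lemma stationaryP (S : chain) : is_stationary S (stationary S).
Proof. by rewrite /stationary; case: cid => p []. Qed.

Definition cost (S : chain) : R := \sum_k ell (S k) * stationary S k.

Definition is_min_cost (S : chain) : Prop := forall S', cost S <= cost S'.

Definition intersection_point (S : chain) : 'rV[R]_n * R :=
  sval (cid (intersection_ex_uniq S)).

Lemma intersection_pointP (S : chain) :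
  is_intersection S (intersection_point S).
Proof. by rewrite /intersection_point; case: cid => xy []. Qed.

(* sel i x is the minimizer S(x) used at step i: ties between minimizers may be
   broken in any way, possibly differently from one step to the next. The
   sequence is continued past the stopping step. *)
Fixpoint iterate (S0 : chain) (sel : nat -> 'rV[R]_n -> chain) (i : nat)
    : 'rV[R]_n :=
  if i is j.+1 then (intersection_point (sel j (iterate S0 sel j))).1
  else (intersection_point S0).1.

Definition stops_at (p : nat -> 'rV[R]_n) (i : nat) : Prop :=
  [/\ (0 < i)%N, p i = p i.-1
    & forall j, (0 < j < i)%N -> p j <> p j.-1].

End Definitions.

(* Main.v *)
(* Each step applies policy improvement: the new chain T minimizes f(x, .) at the
   intersection point (x, y) of the old one, so f_k(x, T_k) <= y for every k,
   and the superharmonic principle for T puts the new point (x', y') below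
   (x, y): y' <= y, and x' <= x when y' = y.  This is a partial order on the
   finite set of intersection points, so the iteration stalls.  Once stalled,
   all g_k(x) equal y, and the same principle applied to any other chain shows
   that its intersection point has height at least y. *)

Require Import Defs.
From HB Require Import structures.
From mathcomp Require Import all_boot all_order all_algebra.
From mathcomp Require Import boolp classical_sets reals.

Set Implicit Arguments.
Unset Strict Implicit.
Unset Printing Implicit Defensive.

Import Order.TTheory GRing.Theory Num.Theory.

Local Open Scope ring_scope.

Section PolicyImprovement.
Context {R : realType} {n : nat} (P : instance R n).
Implicit Types (S T : chain P) (x : 'rV[R]_n) (y : R).

Lemma f_sub x x' k (s : state P k) :
  f x s - f x' s =
  \sum_j q s j * (ext x j - ext x' j) - (ext x k - ext x' k).
Proof.
under eq_bigr do rewrite mulrBr.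
rewrite sumrB !fE !opprD !opprK addrACA; congr (_ + _).
by rewrite addrACA subrr add0r.
Qed.

(** Subtracting [y' = f x' (S k)] from [f x (S k) <= y] cancels the costs, so [ext x - ext x'] is
    superharmonic for [S] up to the slack [y - y']. *)
Lemma intersection_le S x y x' y' : is_intersection S (x', y') ->
    (forall k, f x (S k) <= y) ->
  y' <= y /\ (y' = y -> forall i, x' 0 i <= x 0 i).
Proof.
move=> isect ley; pose d j := ext x j - ext x' j.
have [||y_ge x_ge] := @superharmonic _ _ _ S d (y - y').
- by rewrite /d !ext0 subrr.
- move=> k; rewrite addrC -lerBlDr -f_sub -(isect k) /=.
  by rewrite lerB.
split=> [|yy i]; first by rewrite -subr_ge0.
have := x_ge _ (lift ord0 i); rewrite /d !extS subr_ge0; apply.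
by rewrite yy subrr.
Qed.

(** Same principle with the difference reversed; it supplies the lower bound behind optimality. *)
Lemma intersection_ge S x y x' y' : is_intersection S (x', y') ->
  (forall k, y <= f x (S k)) -> y <= y'.
Proof.
move=> isect gey; pose d j := ext x' j - ext x j.
have [||+ _] := @superharmonic _ _ _ S d (y' - y).
- by rewrite /d !ext0 subrr.
- move=> k; rewrite addrC -lerBlDr -f_sub -(isect k) /=.
  by rewrite lerB.
by rewrite subr_ge0.
Qed.

(** Average the equations [y = f x (S k)] with the stationary weights: stationarity cancels all the
    [ext x] terms. *)
Lemma intersection_cost S x y : is_intersection S (x, y) -> y = cost S.
Proof.
move=> isect; have [_ p1 st] := stationaryP S.
set p := stationary S in p1 st.
have yE k : y * p k = ell (S k) * p k +
    \sum_j p k * q (S k) j * ext x j - p k * ext x k.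
  rewrite -[y]/((x, y).2) (isect k) fE mulrBl mulrDl mulr_suml.
  congr (_ + _ - _); last exact: mulrC.
  by apply: eq_bigr => j _; rewrite mulrC mulrA.
rewrite -[y]mulr1 -p1 mulr_sumr (eq_bigr _ (fun k _ => yE k)).
rewrite sumrB big_split /= -addrA -[RHS]addr0; congr (_ + _).
apply/eqP; rewrite subr_eq0 exchange_big; apply/eqP/eq_bigr => j _.
by rewrite [in RHS]st mulr_suml.
Qed.

Lemma cost_ge0 S : 0 <= cost S.
Proof.
have [p_ge0 _ _] := stationaryP S.
by apply: sumr_ge0 => k _; rewrite mulr_ge0 ?ell_ge0.
Qed.

Lemma intersection_pointE S x y :
  is_intersection S (x, y) -> intersection_point S = (x, y).
Proof.
have [z [_ uniqz] isect] := intersection_ex_uniq S.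
by rewrite -(uniqz _ isect) -(uniqz _ (intersection_pointP S)).
Qed.

Lemma g_le x k (s : state P k) : g P x k <= f x s.
Proof. exact: bigmin_le. Qed.

Lemma h_const x y : (forall k, g P x k = y) -> h P x = y.
Proof.
by move=> gy; rewrite /h gy; apply: (big_ind (fun z => z = y)) => // a b -> ->; rewrite minxx.
Qed.

(** Two chains are needed because ties may make the output [T] differ from the chain [S] that
    produced the point; both share the intersection point [(x, y)]. *)
Lemma argmin_stable S T x y : is_intersection S (x, y) ->
  is_argmin x S -> is_argmin x T ->
  is_min_cost T /\ H P (intersection_point T).
Proof.
move=> isect argS argT.
have gy k : g P x k = y by rewrite -argS -(isect k).
have isT : is_intersection T (x, y) by move=> k; rewrite argT gy.
split=> [S'|].
  rewrite -(intersection_cost isT).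
  have := intersection_pointP S'.
  case: (intersection_point S') => x' y' isect'.
  rewrite -(intersection_cost isect').
  by apply: (intersection_ge (x := x) isect') => k; rewrite -(gy k) g_le.
rewrite (intersection_pointE isT); split => /=.
  by rewrite (intersection_cost isT) cost_ge0.
by rewrite (h_const gy).
Qed.

(** Lexicographic: height first, coordinates compared only at equal height, as the superharmonic
    principle provides. *)
Definition below (a b : 'rV[R]_n * R) : Prop :=
  a.2 <= b.2 /\ (a.2 = b.2 -> forall i, a.1 0 i <= b.1 0 i).

Lemma below_refl a : below a a.
Proof. by []. Qed.

Lemma below_trans a b c : below a b -> below b c -> below a c.
Proof.
move=> [ab2 ab1] [bc2 bc1]; split=> [|ac i]; first exact: le_trans ab2 bc2.
have eab : a.2 = b.2 by apply/eqP; rewrite eq_le ab2 ac bc2.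
by apply: le_trans (ab1 eab i) (bc1 _ i); rewrite -eab.
Qed.

Lemma below_anti a b : below a b -> below b a -> a = b.
Proof.
case: a b => [xa ya] [xb yb] [/= ab2 ab1] [/= ba2 ba1].
have e : ya = yb by apply/eqP; rewrite eq_le ab2 ba2.
congr (_, _) => //; apply/rowP => i.
by apply/eqP; rewrite eq_le ab1 // ba1.
Qed.

Lemma below_argmin S T : is_argmin (intersection_point S).1 T ->
  below (intersection_point T) (intersection_point S).
Proof.
have isS := intersection_pointP S; have isT := intersection_pointP T.
move: isS isT; case: (intersection_point S) => x y.
case: (intersection_point T) => x' y' isS isT /= argT.
apply: (intersection_le isT) => k.
by rewrite argT [y](isS k) g_le.
Qed.

Lemma finite_repeat (F : finType) (c : nat -> F) :
  exists i j, (i < j)%N /\ c i = c j.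
Proof.
have /injectivePn [i [j neq_ij eq_ij]] :
    ~~ injectiveb (fun i : 'I_#|F|.+1 => c i).
  by apply/negP => /injectiveP /leq_card; rewrite card_ord ltnn.
have [lt_ij|lt_ji|/val_inj e] := ltngtP i j.
- by exists i, j.
- by exists j, i.
- by rewrite e eqxx in neq_ij.
Qed.

Lemma stops_ex (p : nat -> 'rV[R]_n) :
  (exists i, p i.+1 = p i) -> exists i, stops_at p i.
Proof.
move=> [i0 e0]; have ex : exists i, p i.+1 == p i by exists i0; apply/eqP.
(* [stops_at] compares an index with its predecessor, hence the shift by one from the least
   stall. *)
case: (ex_minnP ex) => i /eqP pi mini; exists i.+1; split=> // -[//|j] /= lt_ji.
by move/eqP/mini; rewrite leqNgt -ltnS lt_ji.
Qed.

Section Iteration.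
Variables (S0 : chain P) (sel : nat -> 'rV[R]_n -> chain P).
Hypothesis sel_argmin : forall i x, is_argmin x (sel i x).

(** Tracks chains rather than points, since chains form a finite type. *)
Definition iterate_chain i : chain P :=
  if i is j.+1 then sel j (iterate S0 sel j) else S0.

Lemma iterateE i :
  iterate S0 sel i = (intersection_point (iterate_chain i)).1.
Proof. by case: i. Qed.

Lemma below_iterate_chain i j : (i <= j)%N ->
  below (intersection_point (iterate_chain j))
        (intersection_point (iterate_chain i)).
Proof.
move=> /subnK <-; elim: (j - i)%N => [|k IHk]; first exact: below_refl.
apply: below_trans IHk; apply: below_argmin.
by rewrite -iterateE; apply: sel_argmin.
Qed.

Lemma iterate_stalls : exists i, iterate S0 sel i.+1 = iterate S0 sel i.
Proof.
have [i [j [lt_ij eq_ij]]] := finite_repeat iterate_chain.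
(* Point [i.+1] is squeezed between points [j] and [i], which coincide. *)
exists i; rewrite !iterateE; congr _.1; apply: below_anti.
  exact: below_iterate_chain.
by rewrite eq_ij; apply: below_iterate_chain.
Qed.

End Iteration.

End PolicyImprovement.

Theorem theorem1 (R : realType) (n : nat) (m_gt1 : (1 < n.+1)%N)
    (P : instance R n) (S0 : chain P)
    (sel : nat -> 'rV[R]_n -> chain P)
    (sel_argmin : forall i x, is_argmin x (sel i x)) :
  (exists i, stops_at (iterate S0 sel) i) /\
  (forall i, stops_at (iterate S0 sel) i ->
     is_min_cost (sel i (iterate S0 sel i)) /\
     H P (intersection_point (sel i (iterate S0 sel i)))).
Proof.
split; first exact: stops_ex (iterate_stalls S0 sel_argmin).
move=> [|i] [] // _ pE _.
(* [T] was chosen as a minimizer at the previous iterate; stopping makes that its own intersection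
   point. *)
pose T := iterate_chain S0 sel i.+1.
apply: (@argmin_stable _ _ _ T _ (iterate S0 sel i.+1) (intersection_point T).2).
- by rewrite iterateE -surjective_pairing; apply: intersection_pointP.
- by rewrite pE; apply: sel_argmin.
- exact: sel_argmin.
Qed.
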